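(* Let $\kappa$ be an uncountable cardinal. If $\kappa \in \mathfrak{sp}(\text{Borel})$, then $\mathfrak{par}(\kappa^\omega) \in \mathfrak{sp}(\text{Borel})$.
   Context: $\mathfrak{sp}(\text{Borel}) = \{|\mathcal{P}| : \mathcal{P} \text{ is a partition of } \mathbb{R} \text{ into uncountably many Borel sets}\}$. The cardinal $\kappa$ has the discrete topology and $\kappa^\omega$ the product topology. For a topological space $X$, $\mathfrak{par}(X) = \min\{|\mathcal{P}| : \mathcal{P} \text{ is a partition of } X \text{ into Polish subspaces}\}$. *)

(* Defs.v *)
From HB Require Import structures.
From mathcomp Require Import all_boot all_order all_algebra.
From mathcomp Require Import all_classical all_reals all_analysis.

Set Implicit Arguments.
Unset Strict Implicit.
Unset Printing Implicit Defensive.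

Import Order.TTheory GRing.Theory Num.Theory.
Import numFieldNormedType.Exports.

Local Open Scope classical_set_scope.
Local Open Scope ring_scope.
Local Open Scope card_scope.

(* Cardinals are represented by sets, up to the equipotence [#=] and ordered by
   [#<=]. A partition is a set [P] of blocks (the library's indexed [partition]
   taken at the identity family), so that its cardinality is that of [P]. *)

(* [sp_Borel R A] reads |A| \in sp(Borel). *)
Definition sp_Borel (R : realType) (T : Type) (A : set T) : Prop :=
  exists P : set (set R),
    [/\ partition P id [set: R],
        P `<=` <<s @open R >>,
        ~ countable P
      & P #= A].

Definition is_metric (R : realType) (X : Type) (d : X -> X -> R) : Prop :=
  [/\ forall x y, d x y = 0 <-> x = y,
      forall x y, d x y = d y x
    & forall x y z, d x z <= d x y + d y z].

Definition metric_induces (R : realType) (X : topologicalType)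
    (d : X -> X -> R) : Prop :=
  forall U : set X, open U <->
    forall x, U x -> exists2 e : R, 0 < e & [set y | d x y < e] `<=` U.

Definition metric_cauchy_seq (R : realType) (X : Type) (d : X -> X -> R)
    (u : nat -> X) : Prop :=
  forall e : R, 0 < e ->
    exists N : nat, forall m n, (N <= m)%N -> (N <= n)%N -> d (u m) (u n) < e.

Definition metric_complete (R : realType) (X : Type) (d : X -> X -> R) : Prop :=
  forall u : nat -> X, metric_cauchy_seq d u ->
    exists x : X, forall e : R, 0 < e ->
      exists N : nat, forall n, (N <= n)%N -> d (u n) x < e.

Definition completely_metrizable (R : realType) (X : topologicalType) : Prop :=
  exists d : X -> X -> R, [/\ is_metric d, metric_induces d & metric_complete d].

Definition separable_space (X : topologicalType) : Prop :=
  exists2 D : set X, countable D & dense D.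

Definition polish_space (R : realType) (X : topologicalType) : Prop :=
  separable_space X /\ completely_metrizable R X.

(* The block [A] is coerced to the subtype of its elements, whose topology is
   the subspace topology (unlike the library's [subspace A]). *)
Definition polish_partition (R : realType) (X : topologicalType)
    (P : set (set X)) : Prop :=
  partition P id [set: X] /\ forall A : set X, P A -> polish_space R A.

Definition min_polish_partition (R : realType) (X : topologicalType)
    (P : set (set X)) : Prop :=
  polish_partition R P /\
  forall Q : set (set X), polish_partition R Q -> P #<= Q.

(* The cardinal par(X), represented by a chosen partition of least cardinality;
   [parP] shows that there is one. *)
Definition par (R : realType) (X : topologicalType) : set (set X) :=
  [get P | @min_polish_partition R X P].
Arguments par : clear implicits.

Lemma card_le_wf (T : pointedType) (S : set (set T)) :
  S !=set0 -> exists2 P, S P & forall Q, S Q -> P #<= Q.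
Proof.
move=> [Q0 SQ0].
pose Z := [set M : set (set T -> T) |
  (forall f Q, M f -> S Q -> Q (f Q)) /\
  (forall f g Q, M f -> M g -> S Q -> f Q = g Q -> f = g)].
have [|M [[ZM1 ZM2] Mmax]] := @Zorn_bigcup _ Z.
  move=> F FZ Ftot; split=> [f Q [M FM Mf] SQ|f g Q [M FM Mf] [N FN Ng] SQ fg].
    by have [FZ1 _] := FZ _ FM; exact: (FZ1 f Q Mf SQ).
  have [MN|NM] := Ftot _ _ FM FN.
    by have [_ FZ2] := FZ _ FN; exact: (FZ2 f g Q (MN _ Mf) Ng SQ fg).
  by have [_ FZ2] := FZ _ FM; exact: (FZ2 f g Q Mf (NM _ Ng) SQ fg).
have [[P SP PM]|noP] :=
    pselect (exists2 P, S P & P `<=` [set f P | f in M]).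
  exists P => // Q SQ.
  apply: (card_le_trans (subset_card_le PM)).
  apply: (card_le_trans (card_image_le _ _)).
  have inj : {in M &, injective (fun f : set T -> T => f Q)}.
    by move=> f g /set_mem Mf /set_mem Mg; exact: (ZM2 f g Q Mf Mg SQ).
  have := inj_card_eq inj; rewrite card_eq_sym => /card_eqPle[MQ _].
  apply: (card_le_trans MQ); apply: subset_card_le => _ [f Mf <-].
  exact: (ZM1 f Q Mf SQ).
have /choice[a aP] : forall Q, exists x, S Q -> Q x /\ ~ [set f Q | f in M] x.
  move=> Q; have [SQ|] := pselect (S Q); last by exists point.
  apply: contrapT => nx; apply: noP; exists Q => // x Qx.
  by apply: contrapT => nMx; apply: nx; exists x.
exfalso; apply: (Mmax (M `|` [set a])).
  split; first by move=> f Mf; left.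
  move=> /(_ a (or_intror erefl)) Ma.
  by have [_] := aP _ SQ0; apply; exists a.
split=> [f Q [Mf|->] SQ|f g Q [Mf|->] [Mg|->] SQ //].
- exact: (ZM1 f Q Mf SQ).
- by have [] := aP _ SQ.
- exact: (ZM2 f g Q Mf Mg SQ).
- by move=> fa; have [_] := aP _ SQ; case; exists f.
- by move=> ag; have [_] := aP _ SQ; case; exists g.
Qed.

Lemma polish_space_set1 (R : realType) (X : topologicalType) (x : X) :
  polish_space R [set x].
Proof.
have e (a b : [set x]) : a = b.
  apply: val_inj; case: a => a /= /set_mem; case: b => b /= /set_mem.
  by move=> -> ->.
split.
  exists [set: [set x]]; last by move=> O [y Oy] _; exists y.
  apply: finite_set_countable.
  exact: sub_finite_set (finite_set1 (exist _ x (mem_set erefl))).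
exists (fun _ _ => 0); split.
- by split=> // a b; rewrite addr0.
- move=> U; split=> [_ a Ua|_].
    by exists 1 => // b _; rewrite (e b a).
  have [[a Ua]|U0] := pselect (U !=set0).
    suff -> : U = setT by exact: openT.
    by apply/seteqP; split=> // b _; rewrite (e b a).
  suff -> : U = set0 by exact: open0.
  by apply/seteqP; split=> // b Ub; apply: U0; exists b.
- move=> u _; exists (u 0%N) => r r0.
  by exists 0%N.
Qed.

Lemma parP (R : realType) (X : topologicalType) :
  min_polish_partition R (par R X).
Proof.
apply: (@getPex _ (@min_polish_partition R X)).
have [|P pP Pmin] := @card_le_wf _ [set P | @polish_partition R X P].
  exists (range set1); split; last first.
    by move=> _ [x _ <-]; exact: polish_space_set1.
  split.
  - by apply/seteqP; split=> // x _; exists [set x].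
  - by move=> _ _ [x _ <-] [y _ <-] [_ [-> ->]].
  - by move=> _ [x _ <-]; exists x.
by exists P.
Qed.

(* Main.v *)
(* A cardinal is in sp(Borel) when it is uncountable and the image of [R] under
   a map with Borel fibers. Coding the subsets of a countable set by base 3
   digits, and a real by the set of rationals below it, gives a surjection from
   [R] onto [R^nat] with Borel coordinates; following each coordinate by a map
   from [R] onto [K] with Borel fibers gives [psi], from [R] onto [K^nat], such
   that each [psi r i = k] is a Borel condition on [r]. As [K^nat] is not second
   countable, preimages under [psi] of open sets need not be Borel, but those of
   Polish subspaces are: a Polish subspace is a countable intersection of
   countable unions of cylinders, namely those centred in a countable dense set
   and on which the complete metric oscillates little. So sending [r] to the
   block of [psi r] has Borel fibers, for any partition of [K^nat] into Polish
   subspaces. There are uncountably many blocks, since countably many separable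
   subspaces only have countably many 0-th coordinates. *)
Require Import Defs.
From mathcomp Require Import all_boot all_order all_algebra.
From mathcomp Require Import all_classical all_reals all_analysis.
From mathcomp Require Import measurable_realfun ring.

Set Implicit Arguments.
Unset Strict Implicit.
Unset Printing Implicit Defensive.

Import Order.TTheory GRing.Theory Num.Theory.
Import numFieldNormedType.Exports.

Local Open Scope classical_set_scope.
Local Open Scope ring_scope.
Local Open Scope card_scope.

Section pblock_index.
Context {T : Type} {I : pointedType} (D : set I) (F : I -> set T).

Lemma pblock_index_mem (x : T) :
  cover D F x -> D (pblock_index D F x) /\ F (pblock_index D F x) x.
Proof.
by move=> [i Di Fix]; apply: (@getPex _ [set j | D j /\ F j x]); exists i.
Qed.

Lemma pblock_index_eq (x : T) (i : I) :
  trivIset D F -> D i -> F i x -> pblock_index D F x = i.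
Proof.
move=> trivF Di Fix; have [Dj Fjx] := pblock_index_mem (ex_intro2 _ _ i Di Fix).
by apply: trivF => //; exists x.
Qed.

Hypothesis partF : partition D F [set: T].

Lemma preimage_pblock_index (i : I) :
  D i -> pblock_index D F @^-1` [set i] = F i.
Proof.
have [covF trivF _] := partF; move=> Di; apply/seteqP; split=> [x <-|x Fix].
  by have [|] := @pblock_index_mem x; rewrite ?covF.
exact: pblock_index_eq.
Qed.

Lemma range_pblock_index : range (pblock_index D F) = D.
Proof.
have [covF trivF neF] := partF; apply/seteqP; split=> [_ [x _ <-]|i Di].
  by have [|] := @pblock_index_mem x; rewrite ?covF.
by have [x Fix] := neF i Di; exists x => //; exact: pblock_index_eq.
Qed.

End pblock_index.

Section fibers.
Context {T : Type}.

Definition fibers {U : Type} (f : T -> U) : set (set T) :=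
  [set f @^-1` [set u] | u in range f].

Lemma partition_fibers {U : Type} (f : T -> U) :
  partition (fibers f) id [set: T].
Proof.
split.
- apply/seteqP; split=> // x _; exists (f @^-1` [set f x]) => //.
  by exists (f x).
- by move=> _ _ [u _ <-] [v _ <-] [x [/= <- <-]].
- by move=> _ [_ [x _ <-] <-]; exists x.
Qed.

Lemma card_fibers {U : Type} (f : T -> U) : fibers f #= range f.
Proof.
apply: inj_card_eq => _ _ /set_mem[x _ <-] /set_mem[y _ <-] /seteqP[fxy _].
exact: fxy x erefl.
Qed.

Lemma partition_card_fibers {U : pointedType} (P : set (set T)) (A : set U) :
  partition P id [set: T] -> P #= A ->
  exists2 f : T -> U, range f = A & fibers f = P.
Proof.
move=> partP /card_set_bijP[h [hfun hinj hsurj]].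
pose f := h \o pblock_index P id.
have fA : range f = A.
  rewrite -(image_comp _ h) range_pblock_index//.
  by apply: surj_image_eq => //; exact/image_subP.
have fiberE B : P B -> f @^-1` [set h B] = B.
  move=> PB; rewrite -[RHS](preimage_pblock_index partP PB); apply/seteqP.
  split=> x; rewrite /f /=; last by move=> ->.
  apply: hinj; rewrite inE//.
  by rewrite -[X in X _](range_pblock_index partP); exists x.
exists f => //; rewrite /fibers fA; apply/seteqP; split=> [_ [u Au <-]|B PB].
  by have [B PB <-] := hsurj u Au; rewrite fiberE.
by exists (h B); [exact: hfun|exact: fiberE].
Qed.

End fibers.

Section sp_Borel.
Context {R : realType}.

Lemma measurable_openE : @measurable _ R = <<s @open R >>.
Proof.
rewrite [LHS]RGenOpens.measurableE; apply/seteqP; split.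
  apply: smallest_sub; first exact: smallest_sigma_algebra.
  by move=> _ [x [y ->]]; apply: sub_sigma_algebra; exact: interval_open.
rewrite -RGenOpens.measurableE.
apply: smallest_sub; first exact: sigma_algebra_measurable.
by move=> U /open_measurable.
Qed.

Lemma sp_BorelP {T : Type} (A : set T) :
  sp_Borel R A <-> ~ countable A /\
    exists2 f : R -> T, range f = A & fibers f `<=` measurable.
Proof.
rewrite measurable_openE.
split=> [[P [partP borelP ncP PA]]|[ncA [f fA borelf]]].
  split; first by rewrite -(eq_countable PA).
  elim/Ppointed: T => T in A PA *.
    by case: ncP; rewrite (eq_countable PA) emptyE.
  have [f fA fP] := partition_card_fibers partP PA.
  by exists f; rewrite ?fP.
rewrite -{A}fA in ncA *; exists (fibers f); split=> //.
- exact: partition_fibers.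
- by rewrite (eq_countable (card_fibers f)).
- exact: card_fibers.
Qed.

End sp_Borel.

Section digits.
Context {R : realType}.

Definition digit (b k : nat) (r : R) : int :=
  (Num.floor (b%:R ^+ k * r) %% b%:Z)%Z.

Lemma measurable_preimage_floor (A : set int) :
  measurable ((Num.floor : R -> int) @^-1` A).
Proof.
rewrite (_ : _ @^-1` _ = \bigcup_(z in A) `[z%:~R, (z + 1)%:~R[%classic).
  rewrite bigcup_mkcond; apply: countable_bigcupT_measurable => // z.
  by case: ifP.
apply/seteqP; split=> r /=.
  by exists (Num.floor r); rewrite //= in_itv/= floor_itv.
by move=> [z Az] /=; rewrite in_itv /= => /floor_def ->.
Qed.

Lemma measurable_digit (b k : nat) (z : int) :
  measurable [set r | digit b k r = z].
Proof.
rewrite -[X in measurable X]setTI.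
exact: (mulrl_measurable (b%:R ^+ k) measurableT
  (measurable_preimage_floor [set m | (m %% b%:Z)%Z = z])).
Qed.

Fixpoint digit_prefix (b : nat) (c : nat -> nat) (k : nat) : nat :=
  if k is j.+1 then (b * digit_prefix b c j + c k)%N else c 0%N.

Lemma digit_prefix_mod (b : nat) (c : nat -> nat) (k : nat) :
  (c k < b)%N -> (digit_prefix b c k %% b = c k)%N.
Proof. by case: k => [|k] ckb; rewrite /= ?(mulnC b) ?modnMDl modn_small. Qed.

Lemma nested_itv_meet (u v : nat -> R) :
  nondecreasing_seq u -> nonincreasing_seq v -> (forall n, u n <= v n) ->
  exists r, forall n, u n <= r <= v n.
Proof.
move=> u_nd v_ni uv; exists (sup (range u)) => n.
have u_le_v m k : u m <= v k.
  apply: le_trans (u_nd _ _ (leq_maxl m k)) _.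
  exact: le_trans (uv _) (v_ni _ _ (leq_maxr m k)).
apply/andP; split.
  by apply: ub_le_sup; [exists (v 0%N) => _ [m _ <-]|exists n].
by apply: ge_sup => [|_ [m _ <-]//]; exists (u 0%N); exists 0%N.
Qed.

(* Avoiding the digit [b - 1] keeps [r] off the right end points of the nested
   [b]-adic intervals. *)
Lemma digit_surj (b : nat) (c : nat -> nat) :
  (forall k, (c k).+1 < b)%N -> exists r : R, forall k, digit b k r = c k.
Proof.
move=> cb.
have b0 : (0 : R) < b%:R by rewrite ltr0n; exact: leq_ltn_trans (cb 0%N).
have pb k : (0 : R) < b%:R ^+ k by rewrite exprn_gt0.
pose u k : R := (digit_prefix b c k)%:R / b%:R ^+ k.
pose v k : R := (digit_prefix b c k).+1%:R / b%:R ^+ k.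
have rescale k n : n%:R / b%:R ^+ k = (b * n)%:R / b%:R ^+ k.+1 :> R.
  by rewrite natrM exprS; field; rewrite !gt_eqF.
have u_nd k : u k <= u k.+1.
  by rewrite /u (rescale k) ler_pM2r ?invr_gt0// ler_nat leq_addr.
have v_decr k : v k.+1 < v k.
  rewrite /v (rescale k) ltr_pM2r ?invr_gt0// ltr_nat.
  by rewrite mulnSr -addnS ltn_add2l.
have [r ur_vr] : exists r, forall n, u n <= r <= v n.
  apply: nested_itv_meet.
  - exact/nondecreasing_seqP.
  - by apply/nonincreasing_seqP => k; exact/ltW.
  - by move=> k; rewrite ler_pM2r ?invr_gt0// ler_nat.
exists r => k.
have [/andP[uk _] /andP[_ vk]] := (ur_vr k, ur_vr k.+1).
have := le_lt_trans vk (v_decr k).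
rewrite ltr_pdivlMr// mulrC => rv.
move: uk; rewrite ler_pdivrMr// mulrC => ur.
rewrite /digit (@floor_def _ _ (digit_prefix b c k)).
  by rewrite modz_nat digit_prefix_mod// ltnW.
by rewrite -pmulrn ur /= intrD -pmulrn -natr1 in rv *.
Qed.

End digits.

Section borel_surjections.
Context {R : realType}.

Lemma borel_surj_sets (I : countType) :
  exists2 C : R -> set I, range C = [set: set I] &
    forall i, measurable [set r | C r i].
Proof.
exists (fun r => [set i | digit 3 (pickle i) r = 1%:Z]) => [|i]; last first.
  exact: measurable_digit.
apply/seteqP; split=> // S _.
pose c k : nat := oapp (fun i => `[< S i >] : nat) 0%N (unpickle k).
have [|r rc] := @digit_surj R 3 c.
  by move=> k; rewrite /c; case: (unpickle k) => //= i; case: asboolP.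
exists r => //; apply/seteqP; split=> i /=; rewrite rc /c pickleK /=;
  by case: asboolP.
Qed.

Lemma ereal_sup_rat_lt (x : R) :
  ereal_sup [set (ratr q)%:E | q in [set q : rat | ratr q < x]] = x%:E.
Proof.
apply/eqP; rewrite eq_le; apply/andP; split.
  by apply: ge_ereal_sup => _ [q /ltW qx <-]; rewrite lee_fin.
apply/lee_subgt0Pr => e e0; rewrite -EFinB.
have [|q] := @rat_in_itvoo R (x - e) x; first by rewrite ltrBlDr ltrDl.
rewrite in_itv /= => /andP[/ltW xeq qx].
by apply: le_ereal_sup_tmp; exists (ratr q)%:E; [exists q|rewrite lee_fin].
Qed.

Lemma measurable_fun_ereal_sup_image d (T : measurableType d) (I : countType)
    (C : T -> set I) (y : I -> \bar R) :
  (forall i, measurable [set t | C t i]) ->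
  measurable_fun [set: T] (fun t => ereal_sup (y @` C t)).
Proof.
move=> mC; apply: (measurability _ (ErealGenOInfty.measurableE R)).
move=> _ [_ [a ->] <-]; rewrite setTI preimage_itvoy.
rewrite (_ : [set t | _] =
    \bigcup_(i in [set i | (a%:E < y i)%E]) [set t | C t i]).
  rewrite bigcup_mkcond; apply: countable_bigcupT_measurable => // i.
  by case: ifP.
apply/seteqP; split=> [t /ereal_sup_gtP[_ [i Cti <-] ai]|t [i ai Cti]].
  by exists i.
by apply/ereal_sup_gtP; exists (y i) => //; exists i.
Qed.

Lemma borel_surj_real_families (J : countType) :
  exists2 g : R -> J -> R, range g = [set: J -> R] &
    forall j, measurable_fun [set: R] (g ^~ j).
Proof.
have [C Csurj mC] := borel_surj_sets (J * rat)%type.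
pose g r j : R :=
  fine (ereal_sup [set (ratr q)%:E | q in [set q | C r (j, q)]]).
exists g => [|j]; last first.
  apply: measurableT_comp; first exact: fine_measurable.
  by apply: measurable_fun_ereal_sup_image => q; exact: mC.
apply/seteqP; split=> // x _.
have [r _ Cr] : range C [set p | ratr p.2 < x p.1] by rewrite Csurj.
by exists r => //; apply/funext => j; rewrite /g Cr /= ereal_sup_rat_lt.
Qed.

Lemma borel_surj_families {K : Type} (J : countType) (f : R -> K) :
  range f = [set: K] -> (forall k, measurable (f @^-1` [set k])) ->
  exists2 psi : R -> J -> K, range psi = [set: J -> K] &
    forall j k, measurable [set r | psi r j = k].
Proof.
move=> fsurj mf; have [g gsurj mg] := borel_surj_real_families J.
exists (fun r j => f (g r j)) => [|j k].
  apply/seteqP; split=> // x _.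
  have /choice[s fs] : forall j, exists s, f s = x j.
    move=> j; have [s _ fs] : range f (x j) by rewrite fsurj.
    by exists s.
  have [r _ gr] : range g s by rewrite gsurj.
  by exists r => //; apply/funext => j; rewrite gr.
by rewrite -[X in measurable X]setTI; exact: (mg j measurableT _ (mf k)).
Qed.

End borel_surjections.

Lemma open_metric_ball (R : realType) (X : topologicalType) (d : X -> X -> R)
    (x : X) (e : R) :
  is_metric d -> metric_induces d -> open [set y | d x y < e].
Proof.
move=> [_ _ tri] dX; apply/dX => y /= xy.
exists (e - d x y); first by rewrite subr_gt0.
by move=> z /=; rewrite ltrBrDl => yz; apply: le_lt_trans yz.
Qed.

Section metric_subspace.
Context {R : realType} {X : topologicalType} (A : set X).
Variable d : A -> A -> R.
Hypotheses (dm : is_metric d) (dA : metric_induces d).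

Definition diam_lt (e : R) (V : set X) : Prop :=
  forall y z : A, V (\val y) -> V (\val z) -> d y z < e.

Lemma nbhs_diam_lt (x : A) (e : R) :
  0 < e -> exists2 V, nbhs (\val x) V & diam_lt e V.
Proof.
have [d0 dC tri] := dm; move=> e0.
have [V oV Vball] := open_metric_ball x (e / 2) dm dA; exists V.
  apply: open_nbhs_nbhs; split=> //.
  suff : (\val @^-1` V) x by [].
  by rewrite Vball /= (d0 x x).2// divr_gt0.
have small y : V (\val y) -> d x y < e / 2.
  by move=> Vy; have : (\val @^-1` V) y by []; rewrite Vball.
move=> y z /small xy /small xz.
by apply: le_lt_trans (tri y x z) _; rewrite dC (splitr e) ltrD.
Qed.

Lemma complete_cvg_mem (u : nat -> A) (x : X) :
  metric_complete d -> hausdorff_space X -> metric_cauchy_seq d u ->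
  \val (u n) @[n --> \oo] --> x -> A x.
Proof.
have [_ dC _] := dm; move=> dc hX /dc[a ua] ux.
suff ua_cvg : \val (u n) @[n --> \oo] --> \val a.
  by rewrite (cvg_unique hX ux ua_cvg); exact: set_valP.
move=> V; rewrite nbhsE => -[U [oU Ua] UV].
have [e e0 eU] := (dA (\val @^-1` U)).1 (ex_intro2 _ _ U oU erefl) a Ua.
have [N uN] := ua e e0.
by exists N => // n Nn; apply/UV/(eU (u n)); rewrite /= dC; exact: uN.
Qed.

End metric_subspace.

Lemma separable_countable_range (X : topologicalType) (Y : Type) (f : X -> Y) :
  separable_space X -> (forall y, open (f @^-1` [set y])) ->
  countable (range f).
Proof.
move=> [D cD dD] open_fiber.
apply: sub_countable (sub_countable (card_image_le f D) cD).
apply: subset_card_le => _ [x _ <-].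
have [|y [/= fyx Dy]] := dD (f @^-1` [set f x]) _ (open_fiber (f x)).
  by exists x.
by exists y.
Qed.

Notation sequence_space K :=
  (prod_topology (fun _ : nat => discrete_topology K)).

Section sequence_space.
Context {K : choiceType}.
Implicit Types x y : sequence_space K.

Lemma hausdorff_sequence_space : hausdorff_space (sequence_space K).
Proof.
apply: (@hausdorff_product _ (fun=> discrete_topology K)) => _.
by apply: discrete_hausdorff; exact: discrete_space_discrete.
Qed.

Lemma open_coord (i : nat) (k : K) : open [set x : sequence_space K | x i = k].
Proof.
rewrite (_ : mkset _ = @proj nat (fun=> discrete_topology K) i @^-1` [set k])//.
by apply: open_comp => [x _|]; [exact: proj_continuous|exact: discrete_open].
Qed.

Definition cylinder x (m : nat) : set (sequence_space K) :=
  [set y | forall i, (i < m)%N -> y i = x i].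

Lemma cylinder_eq x y (m : nat) :
  cylinder x m y -> cylinder y m = cylinder x m.
Proof. by move=> xy; apply/seteqP; split=> z h i im; rewrite h// xy. Qed.

Lemma sub_cylinder x (m n : nat) :
  (m <= n)%N -> cylinder x n `<=` cylinder x m.
Proof. by move=> mn y yx i im; apply: yx; exact: leq_trans mn. Qed.

Lemma open_cylinder x (m : nat) : open (cylinder x m).
Proof.
elim: m => [|m open_m].
  by rewrite (_ : cylinder x 0 = setT); [exact: openT|exact/seteqP].
rewrite (_ : cylinder x m.+1 = cylinder x m `&` [set y | y m = x m]).
  by apply: openI => //; exact: open_coord.
apply/seteqP; split=> [y yx|y [yx ym] i].
  by split; [move=> i im; exact/yx/ltnW|exact: yx].
by rewrite ltnS leq_eqVlt => /predU1P[->//|/yx].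
Qed.

Lemma nbhs_cylinderP x (V : set (sequence_space K)) :
  nbhs x V <-> exists m, cylinder x m `<=` V.
Proof.
split=> [|[m mV]]; last first.
  by apply: filterS mV _; apply: open_nbhs_nbhs; split; [exact: open_cylinder|].
pose F := filter_from [set: nat] (cylinder x).
have FF : Filter F.
  apply: filter_from_filter; first by exists 0%N.
  move=> m n _ _; exists (maxn m n) => // y yx.
  by split; apply: sub_cylinder yx; rewrite ?leq_maxl ?leq_maxr.
have Fx : F --> x.
  apply/cvg_sup => i U [_ [[W oW <-] Wx WU]].
  by exists i.+1 => // y yx; apply: WU => /=; rewrite /proj yx.
by move=> /Fx[m _ mV]; exists m.
Qed.

Lemma measurable_preimage_cylinder d (T : measurableType d)
    (f : T -> sequence_space K) x (m : nat) :
  (forall i k, measurable [set t | f t i = k]) ->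
  measurable (f @^-1` cylinder x m).
Proof.
move=> mf; rewrite (_ : _ @^-1` _ =
    \bigcap_(i in `I_m) [set t | f t i = x i]) //.
by apply: bigcap_measurableType => i _; exact: mf.
Qed.

End sequence_space.

Section polish_sequence_space.
Context {R : realType} {K : choiceType}.
Implicit Types A : set (sequence_space K).

Definition small_cylinders A (d : A -> A -> R) (D : set A) (n : nat) :
    set (sequence_space K * nat) :=
  [set p | [/\ [set \val y | y in D] p.1, (n <= p.2)%N
    & diam_lt d n.+1%:R^-1 (cylinder p.1 p.2)]].

Lemma countable_small_cylinders A (d : A -> A -> R) (D : set A) (n : nat) :
  countable D -> countable (small_cylinders d D n).
Proof.
move=> cD; have cDN : countable ([set \val y | y in D] `*` [set: nat]).
  by apply: countableX => //; exact: sub_countable (card_image_le _ _) cD.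
by apply: sub_countable cDN; apply: subset_card_le => p [].
Qed.

Lemma polish_subspace_cylindersE A (d : A -> A -> R) (D : set A) :
  is_metric d -> metric_induces d -> metric_complete d -> dense D ->
  A = \bigcap_n \bigcup_(p in small_cylinders d D n) cylinder p.1 p.2.
Proof.
move=> dm dA dc dD; apply/seteqP; split=> [x Ax n _|x small_x].
  pose a : A := exist _ x (mem_set Ax).
  have [|V /nbhs_cylinderP[m0 m0V] dV] :=
      nbhs_diam_lt dm dA a (e := n.+1%:R^-1).
    by rewrite invr_gt0.
  pose m := maxn m0 n.
  have [||y [/= xy Dy]] := dD [set y : A | cylinder x m (\val y)].
  - by exists a.
  - by exists (cylinder x m) => //; exact: open_cylinder.
  exists (\val y, m) => /=; last by rewrite (cylinder_eq xy).
  split=> /=; [by exists y|exact: leq_maxr|].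
  rewrite (cylinder_eq xy) => z w xz xw.
  by apply: dV; apply/m0V/(sub_cylinder (leq_maxl m0 n)).
have /choice[u xu] : forall m, exists y : A, cylinder x m (\val y).
  move=> m; have [[_ k] [/= [y _ <-] mk _] yx] := small_x m I.
  by exists y; apply: (sub_cylinder mk); rewrite (cylinder_eq yx).
apply: (complete_cvg_mem dm dA dc hausdorff_sequence_space (u := u)).
- move=> e e0; pose n := Num.truncn e^-1.
  have [p [_ _ small_p] px] := small_x n I.
  exists p.2 => i j ki kj; apply: lt_trans (small_p _ _ _ _) _.
  + by rewrite -(cylinder_eq px); exact: sub_cylinder ki _ (xu i).
  + by rewrite -(cylinder_eq px); exact: sub_cylinder kj _ (xu j).
  + by rewrite invf_plt ?posrE//; exact: truncnS_gt.
- move=> V /nbhs_cylinderP[m mV]; exists m => // n mn.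
  exact/mV/(sub_cylinder mn)/xu.
Qed.

Lemma measurable_preimage_polish d (T : measurableType d)
    (f : T -> sequence_space K) A :
  (forall i k, measurable [set t | f t i = k]) -> polish_space R A ->
  measurable (f @^-1` A).
Proof.
move=> mf [[D cD dD] [rho [rhom rhoA rhoc]]].
rewrite (polish_subspace_cylindersE rhom rhoA rhoc dD) preimage_bigcap.
apply: bigcap_measurableType => n _; rewrite preimage_bigcup bigcup_set_type.
apply: countable_bigcupT_measurable => [|p].
  by rewrite (eq_countable (card_setT _)); exact: countable_small_cylinders.
exact: measurable_preimage_cylinder.
Qed.

Lemma polish_partition_uncountable (P : set (set (sequence_space K))) :
  ~ countable [set: K] -> polish_partition R P -> ~ countable P.
Proof.
move=> ncK [[covP _ _] polP] cP; apply: ncK.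
pose head_range A := range (fun y : A => (\val y : sequence_space K) 0%N).
have c_head : countable (\bigcup_(A in P) head_range A).
  apply: bigcup_countable => // A /polP[sepA _].
  apply: separable_countable_range sepA _ => k.
  by exists [set x | x 0%N = k] => //; exact: open_coord.
apply: sub_countable c_head; apply: subset_card_le => k _.
have [A PA Ak] : cover P id ((fun=> k) : sequence_space K) by rewrite covP.
by exists A => //; exists (exist _ (fun=> k) (mem_set Ak)).
Qed.

End polish_sequence_space.

Theorem theorem4p3 (R : realType) (K : choiceType) :
  ~ countable [set: K] ->
  sp_Borel R [set: K] ->
  sp_Borel R (par R (prod_topology (fun _ : nat => discrete_topology K))).
Proof.
move=> ncK /sp_BorelP[_ [f fsurj mf]].
have [|psi psi_surj mpsi] := borel_surj_families nat fsurj.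
  by move=> k; apply: mf; exists k => //; rewrite fsurj.
set X := prod_topology _.
have [[partP polP] _] := parP R X.
apply/sp_BorelP; split; first exact: (polish_partition_uncountable (R := R)).
pose block := pblock_index (par R X) id \o psi.
have range_block : range block = par R X.
  by rewrite -(image_comp psi) psi_surj range_pblock_index.
exists block => //; rewrite /fibers range_block => _ [A PA <-].
rewrite comp_preimage preimage_pblock_index//.
exact: measurable_preimage_polish mpsi (polP A PA).
Qed.
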